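(* Let $d\ge1$, let $\mathbf X$ be a random vector in $\mathbb R^d$ with arbitrary law $\mathbb P=\mathbb P_{\mathbf X}$. For any $\delta>0$ the robustified halfspace depth $D_\delta(\cdot|\mathbb P)$ satisfies: (P1) Isometric invariance: $D_\delta(A\mathbf z+\mathbf b|\mathbb P_{A\mathbf X+\mathbf b})=D_\delta(\mathbf z|\mathbb P_{\mathbf X})$ for any $\mathbf z,\mathbf b\in\mathbb R^d$ and any matrix $A\in\mathbb R^{d\times d}$ with $AA^\top=I$. (P2) Null at infinity: $D_\delta(\mathbf z|\mathbb P)\to0$ as $\|\mathbf z\|\to\infty$. (P3) Convex upper level sets: the sets $\{\mathbf z\in\mathbb R^d:D_\delta(\mathbf z|\mathbb P)\ge\alpha\}$ are convex for every $\alpha\in(0,1]$.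
   Context: $\|\cdot\|$ is the Euclidean norm and $\langle\cdot,\cdot\rangle$ the Euclidean inner product. $\mathbb P_{\mathbf X'}$ denotes the law of a random vector $\mathbf X'$. For laws $\mathbb P,\mathbb P'$ on $\mathbb R^d$ (no moment assumption) the Wasserstein distance is $d_W(\mathbb P,\mathbb P')=\inf_\Pi\int\|\mathbf x-\mathbf y\|\,\Pi(\mathrm d\mathbf x,\mathrm d\mathbf y)\in[0,\infty]$, over all joint laws $\Pi$ with marginals $\mathbb P,\mathbb P'$. The robustified halfspace depth is $$D_\delta(\mathbf z|\mathbb P)=\inf_{\mathbf u\in\mathbb R^d:\|\mathbf u\|=1}\ \sup_{\mathbb P':d_W(\mathbb P',\mathbb P)\le\delta}\mathbb P'(\{\mathbf x\in\mathbb R^d:\langle\mathbf u,\mathbf x-\mathbf z\rangle\ge0\})\in[0,1].$$ *)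

(* Defs.v *)
From HB Require Import structures.
From mathcomp Require Import all_boot all_order all_algebra.
From mathcomp Require Import all_classical all_reals all_analysis.
Set Implicit Arguments.
Unset Strict Implicit.
Unset Printing Implicit Defensive.
Import Order.TTheory GRing.Theory Num.Theory.
Import numFieldNormedType.Exports.
Local Open Scope classical_set_scope.
Local Open Scope ring_scope.

Fact borel_mx_display : measure_display.
Proof. exact. Qed.

(* Column vectors (more generally matrices) carry the Borel sigma-algebra of
   the library's entrywise topology. *)
Section borel_mx.
Context {R : realType} (m n : nat).

Let borel : set (set 'M[R]_(m, n)) := <<s @open 'M[R]_(m, n) >>.

Let borel0 : borel set0.
Proof. exact: sigma_algebra0. Qed.

Let borelC A : borel A -> borel (~` A).
Proof. exact: sigma_algebraC. Qed.

Let borel_bigcup (F : (set 'M[R]_(m, n))^nat) :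
  (forall i, borel (F i)) -> borel (\bigcup_i F i).
Proof. exact: sigma_algebra_bigcup. Qed.

HB.instance Definition _ := @isMeasurable.Build borel_mx_display
  'M[R]_(m, n) borel borel0 borelC borel_bigcup.

End borel_mx.

Section euclidean.
Context {R : realType} {d : nat}.

Definition dot (u v : 'cV[R]_d) : R := \sum_(i < d) u i 0 * v i 0.

(* The library's norm on matrices is the sup norm. *)
Definition enorm (u : 'cV[R]_d) : R := Num.sqrt (dot u u).

(* The filter describing [`|z| -> +oo] for the Euclidean norm. *)
Definition enorm_pinfty : set_system 'cV[R]_d :=
  filter_from [set: R] (fun M => [set z | M < enorm z]).

#[global] Instance enorm_pinfty_filter : Filter enorm_pinfty.
Proof.
apply: filter_from_filter; first by exists 0.
move=> M N _ _; exists (Num.max M N) => // z /=.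
by rewrite gt_max => /andP[].
Qed.

Definition affine (A : 'M[R]_d) (b x : 'cV[R]_d) : 'cV[R]_d := A *m x + b.

Lemma continuous_affine (A : 'M[R]_d) (b : 'cV[R]_d) : continuous (affine A b).
Proof.
move=> x B [P nP PB].
have {}nP i j : \forall y \near x, P i j (affine A b y i j).
  have entryE : (fun y : 'cV[R]_d => affine A b y i j) =
      fun y : 'cV[R]_d => \sum_k A i k * y k j + b i j.
    by apply/funext => y; rewrite !mxE.
  have : {for x, continuous (fun y : 'cV[R]_d => affine A b y i j)}.
    rewrite entryE; apply: (@cvgD R R _ (nbhs x)); last exact: cvg_cst.
    apply: cvg_big => [|k _]; first exact: add_continuous.
    by apply: cvgM; [exact: cvg_cst | exact: coord_continuous].
  by move=> /(_ (P i j)); apply; exact: nP.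
have nP' : \forall y \near x, forall i j, P i j (affine A b y i j).
  apply: (filter_forall (nbhs_filter x)) => i.
  by apply: (filter_forall (nbhs_filter x)) => j; exact: nP.
by apply: filterS nP' => y Py; exact: PB.
Qed.

Lemma measurable_affine (A : 'M[R]_d) (b : 'cV[R]_d) :
  measurable_fun [set: 'cV[R]_d] (affine A b).
Proof.
apply: (measurability (@open 'cV[R]_d)) => //.
move=> _ [B oB <-]; rewrite setTI; apply: sub_sigma_algebra.
by move/continuousP : (@continuous_affine A b); apply.
Qed.

HB.instance Definition _ (A : 'M[R]_d) (b : 'cV[R]_d) :=
  isMeasurableFun.Build _ _ _ _ (affine A b) (measurable_affine A b).

End euclidean.

Section wasserstein.
Context {R : realType} {d : nat}.
Local Notation law := (probability 'cV[R]_d R).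
Local Open Scope ereal_scope.

(* Measures are functions on all sets, with unspecified values on nonmeasurable
   ones: equality of laws is only required on Borel sets. *)
Definition coupling (P P' : law)
    (Pi : probability ('cV[R]_d * 'cV[R]_d)%type R) : Prop :=
  (forall B, measurable B -> pushforward Pi fst B = P B) /\
  (forall B, measurable B -> pushforward Pi snd B = P' B).

Definition wasserstein (P P' : law) : \bar R :=
  ereal_inf [set \int[Pi]_xy (enorm (xy.1 - xy.2))%:E | Pi in coupling P P'].

Definition halfspace (u z : 'cV[R]_d) : set 'cV[R]_d :=
  [set x | (0 <= dot u (x - z))%R].

Definition robust_depth (delta : R) (z : 'cV[R]_d) (P : law) : \bar R :=
  ereal_inf [set ereal_sup [set (P' : law) (halfspace u z) |
                              P' in [set P' | wasserstein P' P <= delta%:E]]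
            | u in [set u : 'cV[R]_d | enorm u = 1%R]].

End wasserstein.

(* Main.v *)
(* An isometry maps couplings to couplings of the same cost and halfspaces to
   halfspaces, whence (P1).  For (P2), take u = z / |z|: for every P' in the
   Wasserstein ball the halfspace has P'-mass at most
   P(|y| >= |z| / 2) + 2 (delta + 1) / |z|, uniformly in P'.  For (P3), for
   fixed u the inner supremum is nonincreasing in <u, z>, so each upper level
   set of the depth is an intersection of halfspaces. *)
Require Import Defs.
From HB Require Import structures.
From mathcomp Require Import all_boot all_order all_algebra.
From mathcomp Require Import all_classical all_reals all_analysis.
From mathcomp Require Import measurable_realfun ring lra.
Set Implicit Arguments.
Unset Strict Implicit.
Unset Printing Implicit Defensive.
Import Order.TTheory GRing.Theory Num.Theory.
Import numFieldNormedType.Exports.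
Local Open Scope classical_set_scope.
Local Open Scope ring_scope.

(** * Euclidean inner product, norm and isometries *)

Section dot_product.
Context {R : realType} {d : nat}.
Implicit Types (u v w x y z : 'cV[R]_d) (A : 'M[R]_d).

Lemma dotE u v : dot u v = (u^T *m v) 0 0.
Proof. by rewrite mxE; apply: eq_bigr => i _; rewrite mxE. Qed.

Lemma dotC u v : dot u v = dot v u.
Proof. by apply: eq_bigr => i _; rewrite mulrC. Qed.

Lemma dotDr u v w : dot u (v + w) = dot u v + dot u w.
Proof. by rewrite !dotE mulmxDr mxE. Qed.

Lemma dotZr u (a : R) v : dot u (a *: v) = a * dot u v.
Proof. by rewrite !dotE -scalemxAr mxE. Qed.

Lemma dotNr u v : dot u (- v) = - dot u v.
Proof. by rewrite -scaleN1r dotZr mulN1r. Qed.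

Lemma dotBr u v w : dot u (v - w) = dot u v - dot u w.
Proof. by rewrite dotDr dotNr. Qed.

Lemma dot_ge0 u : 0 <= dot u u.
Proof. by apply: sumr_ge0 => i _; rewrite -expr2 sqr_ge0. Qed.

Lemma enorm0 : enorm (0 : 'cV[R]_d) = 0.
Proof. by rewrite /enorm dotE mulmx0 mxE sqrtr0. Qed.

Lemma enorm_ge0 u : 0 <= enorm u.
Proof. exact: sqrtr_ge0. Qed.

Lemma sqr_enorm u : enorm u ^+ 2 = dot u u.
Proof. by rewrite sqr_sqrtr// dot_ge0. Qed.

Lemma dot_isometry A u v : A^T *m A = 1%:M -> dot (A *m u) (A *m v) = dot u v.
Proof.
by move=> AA; rewrite !dotE trmx_mul -mulmxA (mulmxA _ A) AA mul1mx.
Qed.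

Lemma enorm_isometry A u : A^T *m A = 1%:M -> enorm (A *m u) = enorm u.
Proof. by move=> AA; rewrite /enorm dot_isometry. Qed.

(** Cauchy-Schwarz with a unit vector: the residual [v - dot u v *: u] of the projection onto [u]
    has squared norm [dot v v - dot u v ^+ 2], which is nonnegative. *)
Lemma dot_le_enorm u v : enorm u = 1 -> dot u v <= enorm v.
Proof.
move=> u1; have uu : dot u u = 1 by rewrite -sqr_enorm u1 expr1n.
have := dot_ge0 (v - dot u v *: u).
rewrite dotBr dotZr ![dot (_ - _) _]dotC !dotBr !dotZr uu (dotC v u) => h.
apply: le_trans (ler_norm _) _; rewrite -sqrtr_sqr ler_wsqrtr//; nra.
Qed.

Lemma enorm_normalize z : 0 < enorm z -> enorm ((enorm z)^-1 *: z) = 1.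
Proof.
move=> z0; rewrite [LHS]/enorm dotZr dotC dotZr mulrA -sqr_enorm -expr2 -exprMn.
by rewrite mulVf ?gt_eqF// expr1n sqrtr1.
Qed.

Lemma dot_normalize z : 0 < enorm z -> dot ((enorm z)^-1 *: z) z = enorm z.
Proof.
by move=> z0; rewrite dotC dotZr -sqr_enorm expr2 mulKf// gt_eqF.
Qed.

End dot_product.

(** * Borel measurability of coordinates, inner products, norms and halfspaces *)

Section measurability.
Context {R : realType} {d : nat}.
Implicit Types (u z : 'cV[R]_d).

Lemma measurable_coord (i : 'I_d) :
  measurable_fun [set: 'cV[R]_d] (fun x : 'cV[R]_d => x i 0).
Proof.
apply: (measurability _ (RGenOInfty.measurableE R)) => _ [_ [a ->] <-].
rewrite setTI; apply: sub_sigma_algebra.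
have /continuousP : continuous (fun x : 'cV[R]_d => x i 0).
  exact: coord_continuous.
by apply; exact: interval_open.
Qed.

Lemma measurable_sqrt : measurable_fun [set: R] (@Num.sqrt R).
Proof. by apply: continuous_measurable_fun; exact: sqrt_continuous. Qed.

Context {disp : measure_display} {T : measurableType disp}.

Lemma measurable_dot (f g : T -> 'cV[R]_d) :
  measurable_fun [set: T] f -> measurable_fun [set: T] g ->
  measurable_fun [set: T] (fun t => dot (f t) (g t)).
Proof.
move=> mf mg; apply: measurable_sum => i; apply: measurable_funM.
- exact: measurableT_comp (measurable_coord i) mf.
- exact: measurableT_comp (measurable_coord i) mg.
Qed.


Lemma measurable_enorm (f : T -> 'cV[R]_d) :
  measurable_fun [set: T] f -> measurable_fun [set: T] (fun t => enorm (f t)).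
Proof.
move=> mf; exact: measurableT_comp measurable_sqrt (measurable_dot mf mf).
Qed.

Lemma measurable_le_enorm (r : R) (f : T -> 'cV[R]_d) :
  measurable_fun [set: T] f -> measurable [set t | r <= enorm (f t)].
Proof.
move=> mf; rewrite -[X in measurable X]setTI.
by apply: measurable_fun_le => //; exact: measurable_enorm.
Qed.

End measurability.

Lemma measurable_halfspace (R : realType) (d : nat) (u z : 'cV[R]_d) :
  measurable (halfspace u z).
Proof.
rewrite -[X in measurable X]setTI; apply: measurable_fun_le => //.
under [X in measurable_fun _ X]eq_fun do rewrite dotBr.
by apply: measurable_funB => //; exact: measurable_dot.
Qed.

(** * Couplings and the Wasserstein distance under pushforward *)

Section wasserstein_theory.
Context {R : realType} {d : nat}.
Local Notation law := (probability 'cV[R]_d R).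
Implicit Types (P : law) (u x y z : 'cV[R]_d).

Lemma measurable_cost :
  measurable_fun setT (fun xy : 'cV[R]_d * 'cV[R]_d => enorm (xy.1 - xy.2)).
Proof.
apply: measurableT_comp measurable_sqrt _.
(* Expanding the square leaves only inner products of the two projections, so measurability of the
   vector-valued difference on the product space is never at stake. *)
have -> : (fun xy : 'cV[R]_d * 'cV[R]_d => dot (xy.1 - xy.2) (xy.1 - xy.2)) =
  (fun xy => dot xy.1 xy.1 - 2 * dot xy.1 xy.2 + dot xy.2 xy.2).
  apply/funext => -[x y] /=; rewrite dotBr ![dot (x - y) _]dotC !dotBr.
  by rewrite (dotC y x); ring.
apply: measurable_funD; first apply: measurable_funB.
- exact: measurable_dot.
- by apply: measurable_funM => //; exact: measurable_dot.
- exact: measurable_dot.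
Qed.

Local Open Scope ereal_scope.

Lemma integral_cost_pushforward (disp : measure_display)
    (T : measurableType disp) (mu : {measure set T -> \bar R})
    (f : T -> 'cV[R]_d * 'cV[R]_d) : measurable_fun [set: T] f ->
  \int[pushforward mu f]_xy (enorm (xy.1 - xy.2))%:E =
  \int[mu]_t (enorm ((f t).1 - (f t).2))%:E.
Proof.
move=> mf; rewrite (ge0_integral_pushforward mf)//.
  by apply/measurable_EFinP; exact: measurable_cost.
by move=> xy _; rewrite lee_fin enorm_ge0.
Qed.

(** The diagonal coupling, the image of [P] under [x -> (x, x)], has zero cost. *)
Lemma wasserstein_refl P : wasserstein P P <= 0.
Proof.
have mdiag : measurable_fun setT (fun x : 'cV[R]_d => (x, x)).
  exact: measurable_fun_pair.
pose f : {mfun 'cV[R]_d >-> ('cV[R]_d * 'cV[R]_d)%type} :=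
  HB.pack (fun x : 'cV[R]_d => (x, x)) (isMeasurableFun.Build _ _ _ _ _ mdiag).
apply: ge_ereal_inf; exists (\int[distribution P f]_xy (enorm (xy.1 - xy.2))%:E).
  by exists (distribution P f) => //; split=> B mB.
rewrite integral_cost_pushforward// integral0_eq// => x _ /=.
by rewrite subrr enorm0.
Qed.

(** Applying [f] to both coordinates of a coupling yields a coupling of the image laws, and a
    1-Lipschitz [f] cannot raise its cost. *)
Lemma wasserstein_pushforward (f : {mfun 'cV[R]_d >-> 'cV[R]_d}) P P' :
  (forall x y, (enorm (f x - f y) <= enorm (x - y))%R) ->
  wasserstein (distribution P f) (distribution P' f) <= wasserstein P P'.
Proof.
move=> f1; apply: le_ereal_inf_tmp => _ [Pi [Pi1 Pi2] <-].
have mff : measurable_fun setT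
    (fun xy : 'cV[R]_d * 'cV[R]_d => (f xy.1, f xy.2)).
  by apply: measurable_fun_pair; exact: measurableT_comp.
pose g : {mfun ('cV[R]_d * 'cV[R]_d)%type >-> ('cV[R]_d * 'cV[R]_d)%type} :=
  HB.pack (fun xy : 'cV[R]_d * 'cV[R]_d => (f xy.1, f xy.2))
    (isMeasurableFun.Build _ _ _ _ _ mff).
apply: ge_ereal_inf; exists (\int[distribution Pi g]_xy (enorm (xy.1 - xy.2))%:E).
  exists (distribution Pi g) => //; split=> B mB.
    by rewrite -[RHS]Pi1// -[X in measurable X]setTI; exact: measurable_funP.
  by rewrite -[RHS]Pi2// -[X in measurable X]setTI; exact: measurable_funP.
rewrite integral_cost_pushforward//; apply: ge0_le_integral => //=.
- by move=> xy _; rewrite lee_fin enorm_ge0.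
- by apply/measurable_EFinP; exact: measurableT_comp measurable_cost mff.
- by apply/measurable_EFinP; exact: measurable_cost.
- by move=> xy _; rewrite lee_fin.
Qed.

(** Couplings see their marginals only through Borel sets, so laws that may differ elsewhere as
    functions are interchangeable. *)
Lemma eq_wasserstein P P' Q : (forall B, measurable B -> P B = P' B) ->
  wasserstein Q P = wasserstein Q P'.
Proof.
move=> PP'; congr (ereal_inf (image _ _)); apply/seteqP.
by split=> Pi [Pi1 Pi2]; split=> // B mB; rewrite Pi2// PP'.
Qed.

End wasserstein_theory.

(** * Isometric invariance of the depth *)

Section depth.
Context {R : realType} {d : nat}.
Local Notation law := (probability 'cV[R]_d R).
Implicit Types (P : law) (u x y z b : 'cV[R]_d) (A : 'M[R]_d) (delta : R).

Lemma affineK A b : A^T *m A = 1%:M ->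
  cancel (affine A b) (affine A^T (- (A^T *m b))).
Proof. by move=> AA x; rewrite /affine mulmxDr mulmxA AA mul1mx addrK. Qed.

Lemma affineB A b x y : affine A b x - affine A b y = A *m (x - y).
Proof. by rewrite /affine opprD addrACA subrr addr0 mulmxBr. Qed.

Lemma preimage_affine_halfspace A b u z : A^T *m A = 1%:M ->
  affine A b @^-1` halfspace (A *m u) (affine A b z) = halfspace u z.
Proof.
move=> AA; apply/seteqP; split=> x;
  by rewrite /preimage /halfspace /= affineB dot_isometry.
Qed.

(** The direction [A *m u] competes on the left, and each [P'] near [PA] is carried by the inverse
    motion to a law near [P] giving the same mass to the original halfspace. The converse inequality
    is this lemma for the inverse motion; to serve both ways, [PA] is any law with the right values
    on Borel sets. *)
Lemma robust_depth_isometry_le delta A b z P (PA : law) : A *m A^T = 1%:M ->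
  (forall B, measurable B -> PA B = P (affine A b @^-1` B)) ->
  (robust_depth delta (affine A b z) PA <= robust_depth delta z P)%E.
Proof.
move=> AAt PAE; have AtA := mulmx1C AAt.
apply: le_ereal_inf_tmp => _ [u u1 <-]; apply: ge_ereal_inf.
exists (ereal_sup [set (P' : law) (halfspace (A *m u) (affine A b z)) |
  P' in [set P' | (wasserstein P' PA <= delta%:E)%E]]).
  by exists (A *m u) => //=; rewrite enorm_isometry.
apply: ge_ereal_sup => _ [P' P'PA <-]; apply: le_ereal_sup_tmp.
pose T := affine A^T (- (A^T *m b)).
have TK : cancel (affine A b) T by exact: affineK.
exists (distribution P' T (halfspace u z)).
  exists (distribution P' T) => //=; apply: le_trans P'PA.
  (* Since [T] undoes [affine A b], the image of [PA] under [T] agrees with [P] on Borel sets; both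
     arguments are now images under the isometry [T]. *)
  rewrite (@eq_wasserstein _ _ _ (distribution PA T)).
    apply: wasserstein_pushforward => x y.
    by rewrite affineB enorm_isometry// trmxK.
  move=> B mB; rewrite -[RHS]/(PA (T @^-1` B)) PAE.
    by rewrite -comp_preimage (_ : T \o affine A b = id)//; apply/funext.
  by rewrite -[X in measurable X]setTI; exact: measurable_affine.
rewrite /distribution /pushforward /T -{1}(preimage_affine_halfspace b u z AtA).
rewrite -comp_preimage (_ : affine A b \o _ = id)//.
apply/funext => x /=; rewrite /affine mulmxDr mulmxA AAt mul1mx mulmxN mulmxA.
by rewrite AAt mul1mx subrK.
Qed.

(** * Vanishing of the depth at infinity *)

Lemma robust_depth_ge0 delta z P : 0 <= delta ->
  (0 <= robust_depth delta z P)%E.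
Proof.
move=> delta0; apply: le_ereal_inf_tmp => _ [u _ <-].
(* [P] lies in its own ball, so the supremum is not the empty one, which would be [-oo]. *)
apply: le_ereal_sup_tmp; exists (P (halfspace u z)); last exact: measure_ge0.
by exists P => //=; rewrite (le_trans (wasserstein_refl P)).
Qed.

(** Continuity from above: the exteriors of balls of radius [n] decrease to the empty set. *)
Lemma enorm_tail P (e : R) : 0 < e ->
  exists n : nat, (P [set y | (n%:R <= enorm y)%R] <= e%:E)%E.
Proof.
move=> e0; pose F n := [set y : 'cV[R]_d | n%:R <= enorm y].
have mF n : measurable (F n) by exact: measurable_le_enorm.
have F0 : \bigcap_n F n = set0.
  apply/seteqP; split=> // y /(_ (Num.bound (enorm y)) I) /=.
  by rewrite /F /= leNgt archi_boundP// enorm_ge0.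
have : P \o F @ \oo --> P (\bigcap_n F n).
  apply: nonincreasing_cvg_mu => //.
  - by rewrite (le_lt_trans (probability_le1 _ _))// ltry.
  - exact: bigcap_measurable.
  - move=> m n mn; apply/subsetPset => y; apply: le_trans.
    by rewrite ler_nat.
rewrite F0 measure0 => /fine_cvgP[_] /cvgrPdist_le /(_ _ e0)[N _ hN].
have := hN N (leqnn N); rewrite /= sub0r normrN => h; exists N.
rewrite -(@fineK _ (P _)) ?lee_fin; last first.
  by apply: fin_num_measure; exact: (mF N).
exact: le_trans (ler_norm _) h.
Qed.

(* If [u.x >= u.z] then [u.(x - y)] or [u.y] is at least [u.z / 2]; the former
   is unlikely under a near-optimal coupling by Markov's inequality. *)
Lemma halfspace_le_tail delta P P' u z : enorm u = 1 -> 0 < dot u z ->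
  (wasserstein P' P <= delta%:E)%E ->
  (P' (halfspace u z) <= P [set y | (dot u z / 2 <= enorm y)%R] +
     ((delta + 1) / (dot u z / 2))%:E)%E.
Proof.
move=> u1 uz0 P'P; set r := dot u z / 2.
have r0 : 0 < r by rewrite divr_gt0.
(* The infimum over couplings need not be attained; the slack 1 makes the bound strict and so
   provides a coupling of cost below [delta + 1]. *)
have : (wasserstein P' P < (delta + 1)%:E)%E.
  by rewrite (le_lt_trans P'P)// lte_fin ltrDl.
case/ereal_inf_lt => _ [Pi [Pi1 Pi2] <-] ltPi.
rewrite -Pi1; last exact: measurable_halfspace.
rewrite -Pi2; last exact: measurable_le_enorm.
rewrite /pushforward.
pose far := [set xy : 'cV[R]_d * 'cV[R]_d | r <= enorm (xy.1 - xy.2)].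
have mfar : measurable far.
  rewrite -[X in measurable X]setTI; apply: measurable_fun_le => //.
  exact: measurable_cost.
have mtail : measurable (snd @^-1` [set y : 'cV[R]_d | r <= enorm y]
    : set ('cV[R]_d * 'cV[R]_d)).
  exact: (measurable_le_enorm r measurable_snd).
have : (Pi far <= ((delta + 1) / r)%:E)%E.
  rewrite EFinM lee_pdivlMr// muleC; apply: le_trans (ltW ltPi).
  under eq_integral do rewrite -(ger0_norm (enorm_ge0 _)).
  have := @le_integral_abse _ _ _ Pi setT measurableT
    (fun xy => (enorm (xy.1 - xy.2))%:E) r.
  rewrite setTI.
  under [X in (_ * Pi X)%E]eq_set do rewrite /= ger0_norm ?enorm_ge0// lee_fin.
  by apply => //; apply/measurable_EFinP; exact: measurable_cost.
move=> /(leeD2l (Pi (snd @^-1` [set y | r <= enorm y]))); apply: le_trans.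
apply: le_trans (measureU2 _ mtail mfar); apply: le_measure; rewrite ?inE.
- rewrite -[X in measurable X]setTI; apply: measurable_fst => //.
  exact: measurable_halfspace.
- exact: measurableU.
- move=> [x y]; rewrite /preimage /halfspace /far /= => h.
  have := dot_le_enorm y u1; have := dot_le_enorm (x - y) u1.
  move: h; rewrite !dotBr /r.
  case: (leP (dot u z / 2) (enorm y)) => [|hy h hxy hy']; first by left.
  right; lra.
Qed.

Lemma robust_depth_cvg0 delta P : 0 <= delta ->
  robust_depth delta z P @[z --> enorm_pinfty] --> 0%E.
Proof.
move=> delta0.
have small (e : R) : 0 < e ->
    \forall z \near enorm_pinfty, (0 <= robust_depth delta z P <= e%:E)%E.
  move=> e0; have e20 : 0 < e / 2 by rewrite divr_gt0.
  have [n Pn] := enorm_tail P e20.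
  (* Beyond the first threshold [enorm z / 2] exceeds [n], so the tail term is at most [e / 2];
     beyond the second the Markov term is at most [e / 2]. *)
  exists (Num.max (n%:R * 2) ((delta + 1) / (e / 2) * 2)) => // z /=.
  rewrite gt_max => /andP[nz dz]; rewrite robust_depth_ge0//=.
  have z0 : 0 < enorm z by apply: le_lt_trans nz; rewrite mulr_ge0.
  apply: ge_ereal_inf; set u := (enorm z)^-1 *: z.
  have u1 : enorm u = 1 by exact: enorm_normalize.
  have uz : dot u z = enorm z by exact: dot_normalize.
  exists (ereal_sup [set (P' : law) (halfspace u z) |
      P' in [set P' | (wasserstein P' P <= delta%:E)%E]]); first by exists u.
  apply: ge_ereal_sup => _ [P' P'P <-].
  apply: le_trans (halfspace_le_tail u1 _ P'P) _; rewrite uz//.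
  rewrite [e in leRHS]splitr EFinD; apply: leeD.
    apply: le_trans Pn; apply: le_measure; rewrite ?inE.
    - exact: measurable_le_enorm.
    - exact: measurable_le_enorm.
    - by move=> y /=; apply: le_trans; rewrite ler_pdivlMr// ltW.
  rewrite lee_fin ler_pdivrMr ?divr_gt0// mulrC -ler_pdivrMr//.
  by rewrite ler_pdivlMr// ltW.
(* Convergence to a real limit in [\bar R] means eventual finiteness, for which the bound with
   [e = 1] suffices, and convergence of [fine]. *)
apply/fine_cvgP; split.
  apply: filterS (small 1 ltr01) => z /andP[D0 D1].
  by rewrite ge0_fin_numE// (le_lt_trans D1)// ltry.
apply/cvgrPdist_le => e e0; apply: filterS (small e e0) => z /andP[D0 De] /=.
rewrite sub0r normrN ger0_norm ?fine_ge0// -lee_fin fineK//.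
by rewrite ge0_fin_numE// (le_lt_trans De)// ltry.
Qed.

(** * Convexity of the upper level sets *)

Lemma halfspace_sub u x z : dot u z <= dot u x ->
  halfspace u x `<=` halfspace u z.
Proof.
by move=> zx y; rewrite /halfspace /= !dotBr !subr_ge0; exact: le_trans.
Qed.

Lemma robust_depth_convex delta P (alpha : R) :
  convex_set [set z : 'cV[R]_d | (alpha%:E <= robust_depth delta z P)%E].
Proof.
move=> x y t; rewrite !inE /= => Dx Dy.
apply: le_ereal_inf_tmp => _ [u u1 <-].
(* Lowering [dot u z] enlarges the halfspace, so a depth bound at [w] passes to the supremum at [z]
   in direction [u]. *)
have mono w z : dot u z <= dot u w ->
    (alpha%:E <= robust_depth delta w P)%E ->
    (alpha%:E <= ereal_sup [set (P' : law) (halfspace u z) |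
      P' in [set P' | (wasserstein P' P <= delta%:E)%E]])%E.
  move=> zw Dw; apply: le_trans Dw _; apply: le_trans.
    by apply: ereal_inf_lbound; exists u.
  apply: ge_ereal_sup => _ [P' P'P <-]; apply: le_ereal_sup_tmp.
  exists (P' (halfspace u z)); first by exists P'.
  apply: le_measure; rewrite ?inE; [exact: measurable_halfspace..|].
  exact: halfspace_sub.
have uE : dot u (conv t x y) = t%:num * dot u x + (1 - t%:num) * dot u y.
  by rewrite dotDr !dotZr.
have t0 : 0 <= t%:num by exact: ge0.
have t1 : t%:num <= 1 by exact: le1.
(* At the convex combination [dot u] is at most the larger of its endpoint values, so the endpoint
   attaining that value supplies the bound. *)
have [xy|/ltW yx] := leP (dot u x) (dot u y).
  by apply: mono Dy; rewrite uE; nra.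
by apply: mono Dx; rewrite uE; nra.
Qed.

End depth.

Theorem proposition2 (R : realType) (d : nat) (d_gt0 : (0 < d)%N)
    (disp : measure_display) (Omega : measurableType disp)
    (Q : probability Omega R) (X : {RV Q >-> 'cV[R]_d})
    (delta : R) (delta_gt0 : 0 < delta) :
  [/\ (* isometric invariance *)
      forall (z b : 'cV[R]_d) (A : 'M[R]_d), A *m A^T = 1%:M ->
        robust_depth delta (A *m z + b) (distribution Q (affine A b \o X)) =
        robust_depth delta z (distribution Q X),
      (* null at infinity *)
      robust_depth delta z (distribution Q X) @[z --> enorm_pinfty] --> 0%E
    & (* convex upper level sets *)
      forall alpha : R, 0 < alpha <= 1 ->
        convex_set [set z : 'cV[R]_d |
          (alpha%:E <= robust_depth delta z (distribution Q X))%E]].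
Proof.
split=> [z b A AAt||alpha _].
- apply/eqP; rewrite eq_le robust_depth_isometry_le//=.
  have AtA := mulmx1C AAt; have TK := affineK b AtA.
  (* For the reverse inequality, [z] is viewed as the image of [affine A b z] under the inverse
     motion, whose matrix is [A^T]. *)
  rewrite -[z in leLHS]TK; apply: robust_depth_isometry_le.
    by rewrite trmxK.
  move=> B mB; rewrite -[LHS]/(Q (X @^-1` B)).
  set T := affine A^T _.
  rewrite -[RHS]/(Q ((T \o (affine A b \o X)) @^-1` B)).
  by congr (Q (preimage _ B)); apply/funext => w; rewrite /= /T TK.
- by apply: robust_depth_cvg0; exact: ltW.
- exact: robust_depth_convex.
Qed.
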